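(* Consider the complex network of $N$ nonlinearly coupled nodes $$\dot{\mathbf{x}}_{i}=f(\mathbf{x}_{i})-c\sum_{k=1}^{N} L_{ik}\, g(\mathbf{x}_{k}),\qquad i\in\{1,\ldots,N\},$$ with $\mathbf{x}_i\in\mathbb{R}^n$, and let $\mathcal{X}\subset\mathbb{R}^n$ and $\mathcal{X}_T\subset\mathcal{X}$ be the state set and target set. If $V:\overline{\mathcal{X}}\to\mathbb{R}$ is an exponential guidance-barrier function (EGBF) for this network with respect to $\mathcal{X}$ and $\mathcal{X}_T$, then $$\mathcal{R}=\{\triangle\mathbf{x}_{ij}\in\mathcal{X}\mid V(\triangle\mathbf{x}_{ij})>0\}\qquad (i\neq j,\ i,j\in\{1,\ldots,N\})$$ is a subset of the region of synchronization (ROS) along the synchronization manifold of the network. That is, for all $i\ne j$ in $\{1,\ldots,N\}$ and every trajectory of the network whose initial error $\triangle\mathbf{x}_{ij}(0)=\mathbf{x}_i(0)-\mathbf{x}_j(0)$ satisfies $\triangle\mathbf{x}_{ij}(0)\in\mathcal{X}$ and $V(\triangle\mathbf{x}_{ij}(0))>0$, there exists $T>0$ such that $\triangle\mathbf{x}_{ij}(T)\in\mathcal{X}_T$ and $\triangle\mathbf{x}_{ij}(t)\in\mathcal{X}$ for all $t\in[0,T]$.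
   Context: Network data: $f:\mathbb{R}^n\to\mathbb{R}^n$ is a smooth vector field, $c>0$ is the coupling strength, $g:\mathbb{R}^n\to\mathbb{R}^n$ is the nonlinear coupling function, and $L=(L_{ij})\in\mathbb{R}^{N\times N}$ is the Laplacian matrix of a digraph: for $i\ne j$, $L_{ij}<0$ if there is a directed connection from node $j$ to node $i$ and $L_{ij}=0$ otherwise, and $L_{ii}=-\sum_{j\neq i}L_{ij}$. For any initial state $\mathbf{X}_0\in\mathbb{R}^{nN}$ the solution trajectory $\mathbf{X}(t)=[\mathbf{x}_1(t)^\top,\ldots,\mathbf{x}_N(t)^\top]^\top$ is defined on $[0,+\infty)$. Error vectors: $\triangle\mathbf{x}_{ij}=\mathbf{x}_i-\mathbf{x}_j$ for $i\neq j$. The synchronization manifold is $\mathcal{S}=\{\mathbf{X}\in\mathbb{R}^{nN}\mid \mathbf{x}_i=\mathbf{x}_j,\ i,j\in\{1,\ldots,N\}\}$. State and target sets: $h:\mathbb{R}^n\to\mathbb{R}$ is continuous and $\mathcal{X}=\{x\in\mathbb{R}^n\mid h(x)>0\}$ is a bounded open set, with closure $\overline{\mathcal{X}}=\{x\mid h(x)\ge 0\}$ and boundary $\partial\mathcal{X}=\{x\mid h(x)=0\}$. For a constant $\varepsilon>0$, $\mathcal{X}_T=\{x\in\mathbb{R}^n\mid \|x\|<\varepsilon\}$ (Euclidean norm), and $\mathcal{X}_T\subset\mathcal{X}$. ROS: the set of initial errors $\triangle\mathbf{x}_{ij}^0\in\mathbb{R}^n$ ($i\ne j$) such that for any error trajectory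 $\triangle\mathbf{x}_{ij}(t)$ of the network starting from $\triangle\mathbf{x}_{ij}^0$ there is $T>0$ with $\triangle\mathbf{x}_{ij}(T)\in\mathcal{X}_T$ and $\triangle\mathbf{x}_{ij}(t)\in\mathcal{X}$ for all $t\in[0,T]$. EGBF: a continuously differentiable function $V:\overline{\mathcal{X}}\to\mathbb{R}$ for which there exists $\lambda>0$ such that, for all $i,j\in\{1,\ldots,N\}$ and all node states $\mathbf{x}_1,\ldots,\mathbf{x}_N\in\mathbb{R}^n$, writing $\triangle\mathbf{x}_{ij}=\mathbf{x}_i-\mathbf{x}_j$, $$\mathcal{L}_V(\triangle\mathbf{x}_{ij},\mathbf{x}_i,\mathbf{x}_j)-\lambda V(\triangle\mathbf{x}_{ij})\ge 0\quad\text{whenever }\triangle\mathbf{x}_{ij}\in\overline{\mathcal{X}\setminus\mathcal{X}_T},$$ $$V(\triangle\mathbf{x}_{ij})\le 0\quad\text{whenever }\triangle\mathbf{x}_{ij}\in\partial\mathcal{X},$$ where $\mathcal{L}_V(\triangle\mathbf{x}_{ij},\mathbf{x}_i,\mathbf{x}_j)=\nabla V(\triangle\mathbf{x}_{ij})\,(\dot{\mathbf{x}}_i-\dot{\mathbf{x}}_j)$, with $\dot{\mathbf{x}}_i,\dot{\mathbf{x}}_j$ denoting the right-hand sides of the network equations. *)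

(* Defs.v *)
From HB Require Import structures.
From mathcomp Require Import all_boot all_order all_algebra.
From mathcomp Require Import all_classical all_reals all_analysis.

Set Implicit Arguments.
Unset Strict Implicit.
Unset Printing Implicit Defensive.

Import Order.TTheory GRing.Theory Num.Theory.
Import numFieldNormedType.Exports.

Local Open Scope classical_set_scope.
Local Open Scope ring_scope.

Definition dotv (R : realType) (n : nat) (u v : 'rV[R]_n) : R :=
  \sum_(k < n) u ord0 k * v ord0 k.

(* The library norm `|x| on row vectors is the sup norm; it induces the same
   topology, the same bounded sets and the same derivatives. *)
Definition enorm (R : realType) (n : nat) (x : 'rV[R]_n) : R :=
  Num.sqrt (dotv x x).

Definition boundary (T : topologicalType) (A : set T) : set T :=
  closure A `\` interior A.

Fixpoint is_Ck (R : realType) (n m k : nat) (f : 'rV[R]_n -> 'rV[R]_m) : Prop :=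
  match k with
  | 0 => continuous f
  | k'.+1 => (forall x, differentiable f x) /\
             (forall v : 'rV[R]_n, is_Ck k' (fun x => 'D_v f x))
  end.

Definition smooth (R : realType) (n m : nat) (f : 'rV[R]_n -> 'rV[R]_m) : Prop :=
  forall k, is_Ck k f.

(* [E j i] means that there is a directed connection from node j to node i. *)
Definition is_laplacian (R : realType) (N : nat) (E : rel 'I_N) (L : 'M[R]_N)
    : Prop :=
  (forall i j, i != j ->
     (E j i -> L i j < 0) /\ (~~ E j i -> L i j = 0)) /\
  (forall i, L i i = - \sum_(j < N | j != i) L i j).

Definition network_field (R : realType) (n N : nat)
    (f : 'rV[R]_n -> 'rV[R]_n) (c : R) (g : 'rV[R]_n -> 'rV[R]_n)
    (L : 'M[R]_N) (x : 'I_N -> 'rV[R]_n) (i : 'I_N) : 'rV[R]_n :=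
  f (x i) - c *: \sum_(k < N) L i k *: g (x k).

(* Solutions on [0, +oo[ of x_i' = F_i(x_1, ..., x_N): the derivative at time 0
   is one-sided, and the values of [x] at negative times are irrelevant. *)
Definition is_trajectory (R : realType) (n N : nat)
    (F : ('I_N -> 'rV[R]_n) -> 'I_N -> 'rV[R]_n) (x : 'I_N -> R -> 'rV[R]_n)
    : Prop :=
  (forall i (t : R), 0 < t ->
     is_derive t (1 : R) (x i) (F (fun k => x k t) i)) /\
  (forall i, s^-1 *: (x i s - x i 0) @[s --> 0^'+] --> F (fun k => x k 0) i).

Definition state_set (R : realType) (n : nat) (h : 'rV[R]_n -> R)
    : set 'rV[R]_n := [set x | 0 < h x].

Definition target_set (R : realType) (n : nat) (eps : R)
    : set 'rV[R]_n := [set x | enorm x < eps].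

Definition ROS (R : realType) (n N : nat)
    (F : ('I_N -> 'rV[R]_n) -> 'I_N -> 'rV[R]_n) (X XT : set 'rV[R]_n)
    : set 'rV[R]_n :=
  [set d0 | forall (i j : 'I_N) (x : 'I_N -> R -> 'rV[R]_n),
     i != j -> is_trajectory F x -> x i 0 - x j 0 = d0 ->
     exists T : R, [/\ 0 < T, XT (x i T - x j T) &
       forall t, 0 <= t <= T -> X (x i t - x j t)]].

(* V belongs to C^1(closure X), X open: V is continuous on closure X and
   differentiable on X, and its gradient on X extends to a field [dV] that is
   continuous on closure X. This extension is unique on closure X; it is the
   gradient of V there. Values outside closure X are irrelevant. *)
Definition C1_on_closure (R : realType) (n : nat) (X : set 'rV[R]_n)
    (V : 'rV[R]_n -> R) (dV : 'rV[R]_n -> 'rV[R]_n) : Prop :=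
  [/\ {within closure X, continuous V},
      {within closure X, continuous dV} &
      forall x, X x ->
        differentiable V x /\ forall v : 'rV[R]_n, 'd V x v = dotv (dV x) v].

Definition is_EGBF (R : realType) (n N : nat)
    (F : ('I_N -> 'rV[R]_n) -> 'I_N -> 'rV[R]_n) (X XT : set 'rV[R]_n)
    (V : 'rV[R]_n -> R) : Prop :=
  exists dV : 'rV[R]_n -> 'rV[R]_n,
    C1_on_closure X V dV /\
    exists lambda : R, 0 < lambda /\
      forall (i j : 'I_N) (x : 'I_N -> 'rV[R]_n),
        (closure (X `\` XT) (x i - x j) ->
           0 <= dotv (dV (x i - x j)) (F x i - F x j) - lambda * V (x i - x j)) /\
        (boundary X (x i - x j) -> V (x i - x j) <= 0).

(* Main.v *)
Require Import Defs.
From HB Require Import structures.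
From mathcomp Require Import all_boot all_order all_algebra.
From mathcomp Require Import all_classical all_reals all_analysis.

Import Order.TTheory GRing.Theory Num.Theory.
Import numFieldNormedType.Exports.

Local Open Scope classical_set_scope.
Local Open Scope ring_scope.

(* Suppose that an error trajectory d starting in X with V (d 0) > 0 never enters
   the target set before leaving X. While d stays in X, the guidance inequality
   gives (V o d)' >= lambda * (V o d), so V (d t) >= exp (lambda t) * V (d 0).
   If d leaves X, then V (d tau) > 0 at the first exit time tau, although
   d tau lies on the boundary, where V <= 0. If d stays in X forever, then V is
   unbounded on X, although V is continuous on the compact closure of X. *)

(** Needed because [V] is continuous only relative to [closure X]: it can be composed with a path as
    long as the path stays in that set. *)
Lemma within_continuous_compS (S T U : topologicalType) (A : set S) (B : set T)
    (f : S -> T) (g : T -> U) :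
  (forall x, A x -> B (f x)) ->
  {within A, continuous f} -> {within B, continuous g} ->
  {within A, continuous (g \o f)}.
Proof.
move=> fAB /subspace_continuousP cf /subspace_continuousP cg.
apply/subspace_continuousP => x Ax W /(cg _ (fAB _ Ax)) gW.
have := cf x Ax _ gW; rewrite /= /nbhs /= /within /=.
apply: filterS => y fyP Ay; exact: fyP (fAB _ Ay).
Qed.

(** The time [tau] is the infimum of the times at which [phi] is nonpositive, so [phi] is positive
    before it. *)
Lemma first_exit (R : realType) (phi : R -> R) (t0 : R) :
  {within `[0, +oo[, continuous phi} -> 0 < phi 0 -> 0 <= t0 -> phi t0 <= 0 ->
  exists tau, [/\ 0 < tau, phi tau = 0 &
    forall t, 0 <= t < tau -> 0 < phi t].
Proof.
move=> cphi phi0 t0_ge0 phit0.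
pose A := [set t | 0 <= t /\ phi t <= 0].
have lbA : has_lbound A by exists 0 => t [].
have infA : has_inf A by split => //; exists t0.
have tau_ge0 : 0 <= inf A by apply: lb_le_inf; [exists t0|move=> t []].
have phi_gt0 t : 0 <= t < inf A -> 0 < phi t.
  move=> /andP[t_ge0 t_lt]; rewrite ltNge; apply/negP => phit.
  by have := ge_inf lbA (conj t_ge0 phit); rewrite leNgt t_lt.
(* Otherwise continuity keeps [phi] positive on some [[inf A, inf A + e[], an interval that meets
   [A] by the definition of the infimum. *)
have phi_tau : phi (inf A) <= 0.
  rewrite leNgt; apply/negP => phi_tau.
  move/subspace_continuousP : cphi => /(_ (inf A)).
  rewrite /= in_itv /= andbT => /(_ tau_ge0) /cvgrPdist_lt /(_ _ phi_tau).
  rewrite /nbhs /= /within /= => /nbhs_ballP[e /= e0 He].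
  have [s [s_ge0 phis] s_lt] := inf_adherent e0 infA.
  have s_ge := ge_inf lbA (conj s_ge0 phis).
  have /He : ball (inf A) e s.
    by rewrite /ball /= distrC ger0_norm ?subr_ge0// ltrBlDl.
  rewrite in_itv /= s_ge0 => /(_ isT) /ltr_normlW.
  by rewrite ltrBlDr ltrDl ltNge phis.
have tau_gt0 : 0 < inf A.
  rewrite lt_neqAle tau_ge0 andbT; apply/eqP => tau0.
  by move: phi_tau; rewrite -tau0 leNgt phi0.
exists (inf A); split => //.
(* The intermediate value theorem gives a zero [r] in [[0, inf A]]; positivity before [inf A] forces
   [r = inf A]. *)
have [| |r] := @IVT R phi 0 (inf A) 0 tau_ge0.
- apply: continuous_subspaceW cphi => x /=.
  by rewrite !in_itv /= andbT => /andP[].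
- by rewrite ge_min phi_tau orbT le_max (ltW phi0).
rewrite in_itv /= [X in _ && X]le_eqVlt => /andP[r_ge0 /orP[/eqP-> //|r_lt]] phir.
by have := phi_gt0 r; rewrite r_ge0 r_lt phir ltxx => /(_ isT).
Qed.

(** Integrating factor: [expR (- lambda * t) * w t] has derivative [expR (- lambda * t) * (dw t -
    lambda * w t)], which is nonnegative, so its values at 0 and [b] are ordered. *)
Lemma gronwall_le (R : realType) (w dw : R -> R) (lambda b : R) :
  0 <= b -> {within `[0, b], continuous w} ->
  (forall t, t \in `]0, b[ -> is_derive t 1 w (dw t)) ->
  (forall t, t \in `]0, b[ -> lambda * w t <= dw t) ->
  expR (lambda * b) * w 0 <= w b.
Proof.
move=> b0 cw w' dw_ge.
pose e (t : R) := expR (- lambda * t).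
have e' (t : R) : is_derive t 1 e (e t * - lambda).
  apply: is_derive1_comp; rewrite -[X in is_derive _ _ _ X]mulr1.
  exact: is_deriveZ.
have ew' t : t \in `]0, b[ -> is_derive t 1 (e * w) (e t * (dw t - lambda * w t)).
  move=> tb; have wt := w' _ tb; apply: is_derive_eq.
  by rewrite /GRing.scale /= mulrBr !mulrN mulrCA (mulrC (w t)).
have : e 0 * w 0 <= e b * w b.
  apply: (@ger0_derive1_ndecr R (e * w) 0 b _ _ _ 0 b (lexx _) b0 (lexx _)).
  - by move=> t /ew' [].
  - move=> t tb; have [_ ewE] := ew' _ tb.
    by rewrite derive1E ewE mulr_ge0 ?expR_ge0// subr_ge0 dw_ge.
  - apply/subspace_continuousP => t tb; apply: cvgM.
      apply: cvg_within_filter; apply: differentiable_continuous.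
      by apply/derivable1_diffP; case: (e' t).
    by move/subspace_continuousP: cw; exact.
rewrite /e mulr0 expR0 mul1r mulNr expRN mulrC.
by rewrite ler_pdivlMr ?expR_gt0// mulrC.
Qed.

Lemma expR_unbounded (R : realType) (lambda a M : R) :
  0 < lambda -> 0 < a -> exists t, 0 <= t /\ M < expR (lambda * t) * a.
Proof.
(* With this witness, [expR y >= 1 + y] yields [expR (lambda * t) >= 1 + |M| / a > M / a]. *)
move=> l0 a0; exists (`|M| / (lambda * a)); split.
  by rewrite divr_ge0// mulr_ge0// ltW.
rewrite -ltr_pdivrMr//; apply: lt_le_trans (expR_ge1Dx _).
have -> : lambda * (`|M| / (lambda * a)) = `|M| / a.
  by rewrite invfM mulrCA mulVKf ?gt_eqF.
apply: (@le_lt_trans _ _ (`|M| / a)); last by rewrite ltrDr.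
by rewrite ler_pM2r ?invr_gt0// ler_norm.
Qed.

Lemma is_derive_comp_grad (R : realType) (n : nat) (V : 'rV[R]_n -> R)
    (G : 'rV[R]_n) (d : R -> 'rV[R]_n) (d' : 'rV[R]_n) (t : R) :
  differentiable V (d t) -> (forall v, 'd V (d t) v = dotv G v) ->
  is_derive t (1 : R) d d' -> is_derive t (1 : R) (V \o d) (dotv G d').
Proof.
move=> dV VE [/derivable1_diffP dd dE].
have cd : differentiable (V \o d) t by exact: differentiable_comp.
split; first exact/derivable1_diffP.
by rewrite -dE !deriveE// diff_comp//= VE.
Qed.

Lemma trajectory_continuous (R : realType) (n N : nat)
    (F : ('I_N -> 'rV[R]_n) -> 'I_N -> 'rV[R]_n) (x : 'I_N -> R -> 'rV[R]_n) i :
  is_trajectory F x -> {within `[0, +oo[, continuous (x i)}.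
Proof.
move=> [x' x'0]; apply/continuous_within_itvcyP; split.
  move=> t; rewrite in_itv /= andbT => t0.
  have [xt _] := x' i t t0.
  exact/differentiable_continuous/derivable1_diffP.
(* At time 0 only the right difference quotient converges; for [s > 0], [x i s] is [s] times that
   quotient plus [x i 0], hence tends to [x i 0]. *)
have id0 : (s : R) @[s --> (0 : R)^'+] --> (0 : R).
  by apply: cvg_within_filter; exact: cvg_id.
have := cvgD (cvgZ id0 (x'0 i)) (cvg_cst (x i 0)).
rewrite scale0r add0r => /(_ _ _ _); apply: cvg_trans; apply: near_eq_cvg.
near=> s; rewrite addrfctE scalerA divff ?scale1r ?subrK//.
Unshelve. all: by end_near. Qed.

(** The endpoints need only lie in [closure X], where [V] is continuous but possibly not
    differentiable; this allows [b] to be an exit time. *)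
Lemma barrier_growth (R : realType) (n : nat) (X : set 'rV[R]_n)
    (V : 'rV[R]_n -> R) (dV : 'rV[R]_n -> 'rV[R]_n) (lambda b : R)
    (d d' : R -> 'rV[R]_n) :
  C1_on_closure X V dV -> 0 <= b -> {within `[0, b], continuous d} ->
  (forall t, 0 <= t <= b -> closure X (d t)) ->
  (forall t, 0 < t < b -> X (d t)) ->
  (forall t, 0 < t < b -> is_derive t (1 : R) d (d' t)) ->
  (forall t, 0 < t < b -> 0 <= dotv (dV (d t)) (d' t) - lambda * V (d t)) ->
  expR (lambda * b) * V (d 0) <= V (d b).
Proof.
move=> [cV _ VdV] b0 cd dX dX' dd ineq.
apply: (@gronwall_le _ (V \o d) (fun t => dotv (dV (d t)) (d' t))) => //.
- by apply: within_continuous_compS cd cV => t /=; rewrite in_itv; exact: dX.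
- move=> t; rewrite in_itv /= => tb; have [? ?] := VdV _ (dX' _ tb).
  by apply: is_derive_comp_grad => //; exact: dd.
- by move=> t; rewrite in_itv /= => tb; rewrite -subr_ge0 ineq.
Qed.

Lemma bounded_above_on_closure (R : realType) (n : nat) (X : set 'rV[R]_n)
    (V : 'rV[R]_n -> R) :
  bounded_set X -> {within closure X, continuous V} ->
  exists M, forall x, closure X x -> V x <= M.
Proof.
move=> bX cV.
have [->|/set0P X0] := eqVneq (closure X) set0; first by exists 0.
have cptX : compact (closure X).
  apply: bounded_closed_compact; last exact: closed_closure.
  (* A norm bound on [X] passes to its closure because closed balls are closed. *)
  apply: (filterS (F := +oo) _ bX) => M XM x /(closureS (B := Num.norm @^-1` [set r | r <= M]) XM).
  by apply: preimage_closed; [move=> y _; exact: norm_continuous|exact: closed_le].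
have [c _ Vc] := EVT_max_rV X0 cptX cV.
by exists (V c) => x xX; apply: Vc; rewrite inE.
Qed.

Theorem theorem1 (R : realType) (n N : nat)
    (f : 'rV[R]_n -> 'rV[R]_n) (c : R) (g : 'rV[R]_n -> 'rV[R]_n)
    (E : rel 'I_N) (L : 'M[R]_N) (h : 'rV[R]_n -> R) (eps : R)
    (V : 'rV[R]_n -> R)
    (f_smooth : smooth f)
    (c_gt0 : 0 < c)
    (L_laplacian : is_laplacian E L)
    (global_solutions : forall x0 : 'I_N -> 'rV[R]_n,
       exists x : 'I_N -> R -> 'rV[R]_n,
         is_trajectory (network_field f c g L) x /\ forall i, x i 0 = x0 i)
    (h_continuous : continuous h)
    (X_bounded : bounded_set (state_set h))
    (X_open : open (state_set h))
    (X_closure : closure (state_set h) = [set x | 0 <= h x])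
    (X_boundary : boundary (state_set h) = [set x | h x = 0])
    (eps_gt0 : 0 < eps)
    (XT_sub_X : target_set eps `<=` state_set h)
    (V_EGBF : is_EGBF (network_field f c g L) (state_set h) (target_set eps) V) :
  [set d | state_set h d /\ 0 < V d]
    `<=` ROS (network_field f c g L) (state_set h) (target_set eps).
Proof.
move=> d0 [Xd0 Vd0] i j x ij xtraj xd0.
pose F := network_field f c g L.
have [dV [C1V [lambda [lambda_gt0 egbf]]]] := V_EGBF.
pose X := state_set h; pose d (t : R) : 'rV[R]_n := x i t - x j t.
have cd : {within `[0, +oo[, continuous d}.
  by apply: within_continuousB; exact: trajectory_continuous xtraj.
have d' (t : R) : 0 < t ->
    is_derive t (1 : R) d (F (fun k => x k t) i - F (fun k => x k t) j).
  by move=> t0; apply: is_deriveB; apply: xtraj.1.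
apply: contrapT => never_reaches.
(* Otherwise [t] itself would serve as the time [T] of the ROS. *)
have outside (t : R) : 0 < t -> (forall s, 0 <= s <= t -> X (d s)) ->
    ~ target_set eps (d t).
  by move=> t0 Xd XTd; apply: never_reaches; exists t.
have growth (b : R) : 0 <= b -> (forall t, 0 <= t < b -> X (d t)) ->
    closure X (d b) -> expR (lambda * b) * V (d 0) <= V (d b).
  move=> b0 Xd Xdb.
  apply: (@barrier_growth _ _ X V dV _ _ _
    (fun t => F (fun k => x k t) i - F (fun k => x k t) j)) => //.
  - apply: continuous_subspaceW cd => t /=.
    by rewrite !in_itv /= andbT => /andP[].
  - move=> t /andP[t0]; rewrite le_eqVlt => /predU1P[->//|tb].
    by apply/subset_closure/Xd; rewrite t0.
  - by move=> t /andP[t0 tb]; apply: Xd; rewrite ltW.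
  - by move=> t /andP[t0 _]; exact: d'.
  (* Before [b] the error has remained in [X], so it is still outside the target and the guidance
     inequality applies. *)
  - move=> t /andP[t0 tb]; apply: (egbf i j (fun k => x k t)).1.
    apply: subset_closure; split; first by apply: Xd; rewrite ltW.
    apply: outside => // s /andP[s0 st]; apply: Xd.
    by rewrite s0 (le_lt_trans st).
have Vd_gt0 : 0 < V (d 0) by rewrite /d xd0.
have [[t [t0 ht]]|stays] := pselect (exists t, 0 <= t /\ h (d t) <= 0).
  have chd : {within `[0, +oo[, continuous (h \o d)}.
    by apply: within_continuous_comp cd => y _; exact: h_continuous.
  have hd0 : 0 < h (d 0) by rewrite /d xd0.
  have [tau [tau0 htau Xd]] := first_exit _ _ _ chd hd0 t0 ht.
  have := growth tau (ltW tau0) Xd.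
  (* The equality [h (d tau) = 0] is used twice: it puts [d tau] in the closure, so that [growth]
     applies up to [tau], and on the boundary, where [V] is nonpositive. *)
  rewrite X_closure /= -[h (d tau)]/((h \o d) tau) htau lexx => /(_ isT).
  apply/negP; rewrite -ltNge; apply: (@le_lt_trans _ _ 0).
    by apply: (egbf i j (fun k => x k tau)).2; rewrite X_boundary.
  by rewrite mulr_gt0 ?expR_gt0.
have Xd (t : R) : 0 <= t -> X (d t).
  by move=> t0; rewrite /X /state_set /= ltNge; apply/negP => ht; apply: stays; exists t.
have [cV _ _] := C1V.
have [M VM] := bounded_above_on_closure _ _ _ _ X_bounded cV.
have [t [t0 Mt]] := expR_unbounded _ _ _ M lambda_gt0 Vd_gt0.
have Xt : closure X (d t) by apply/subset_closure/Xd.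
have := le_trans (growth t t0 (fun s st => Xd s (andP st).1) Xt) (VM _ Xt).
by rewrite leNgt Mt.
Qed.
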